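(* Let $a>0$, let the training environments have mismatch probabilities $\delta_e\in[0,1]$, $e=1,\dots,E$, with positive weights $w_e$ summing to one. Let $\mathbf{D}=[\mathbf{u},\mathbf{v}]\in\mathcal{D}(f_S)$ (columns $\mathbf{u},\mathbf{v}$) and $t=1-(\mathbf{u}^\top\mathbf{v})^2$. Then for each environment $e$ $$J_e(\mathbf{D}f_S)=\frac12\log\left(\frac{1+a+(a^2/4)t}{1+a+a^2\delta_e(1-\delta_e)t}\right).$$ If $\delta_e\ne 1/2$, the maximisers of $\mathbf{D}\mapsto J_e(\mathbf{D}f_S)$ over $\mathcal{D}(f_S)$ are exactly the operators with orthogonal unit columns. If $\delta_e=1/2$, every operator in $\mathcal{D}(f_S)$ is a maximiser. Consequently: 1. For any collection of source mismatch probabilities (including distinct ones), $(f_S,\mathbf{I}_2)$ satisfies the shared-optimality constraint, i.e. $\mathbf{I}_2\in\bigcap_{e}\operatorname{arg\,max}_{\mathbf{A}\in\mathcal{D}(f_S)}J_e(\mathbf{A}f_S)$. 2. $J^*_{\mathrm{ICR}}=J_\star(a)$, and this value is attained by $(f_C,\mathbf{I}_2)$. 3. In the positive-noise construction with tolerance $\eta>0$ (defined in the context), $(f_S,\mathbf{I}_2)$ is a feasible solution of the problem defining $J^*_{\mathrm{ICR}}$ whose objective value $\sum_e w_eJ_e(f_S)$ is within $\eta$ of $J^*_{\mathrm{ICR}}$, yet its source-optimal classifier $g$ has target error $\mathcal{L}_{\mathrm{te}}(g\circ f_S)\ge 1-\eta$. The identity operator is also optimal on the reversed target environment: if the mismatch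 probability $\delta$ of an environment is replaced by $1-\delta$, then $\mathbf{I}_2$ maximises $\mathbf{A}\mapsto J(\mathbf{A}f_S)$ over $\mathcal{D}(f_S)$, where $J$ is the coding objective of the environment with mismatch probability $1-\delta$.
   Context: Environment model. For $\delta\in[0,1]$, $P_\delta$ is the law of $(\mathbf{X},Y)$ with $Y\sim\mathrm{Bernoulli}(1/2)$, $\mathbf{X}=(C,S)\in\{0,1\}^2$, $C=Y$, $S=Y\oplus B$ (exclusive-or), $B\sim\mathrm{Bernoulli}(\delta)$ independent of $Y$. The number $\delta$ is the mismatch probability. Training (source) environment $e$ has law $P_e=P_{\delta_e}$; the target environment has law $P_{\mathrm{te}}=P_{\delta_{\mathrm{te}}}$. Encoders. $\mathcal{F}$ is the set of all functions $f:\{0,1\}^2\to\mathbb{S}^1\subset\mathbb{R}^2$ ($\mathbb{S}^1$ is the unit circle). With $\mathbf{b}_0=(1,0)^\top$, $\mathbf{b}_1=(0,1)^\top$, set $f_C(c,s)=\mathbf{b}_c$, $f_S(c,s)=\mathbf{b}_s$. Coding objective. For $h\in\mathcal{F}$ and environment $e$, let $\mathbf{M}_{e,y}(h)=\mathbb{E}_e[h(\mathbf{X})h(\mathbf{X})^\top\mid Y=y]$ and $\mathbf{M}_e(h)=\tfrac12(\mathbf{M}_{e,0}(h)+\mathbf{M}_{e,1}(h))$. For $a>0$, $$J_e(h)=\tfrac12\log\det(\mathbf{I}_2+a\mathbf{M}_e(h))-\tfrac14\sum_{y\in\{0,1\}}\log\det(\mathbf{I}_2+a\mathbf{M}_{e,y}(h)),$$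 and likewise for any other environment of the model. Also $J_\star(a)=\log(1+a/2)-\tfrac12\log(1+a)$. Coding operators. For $f\in\mathcal{F}$, $\mathcal{D}(f)=\{\mathbf{D}\in\mathbb{R}^{2\times2}:\|\mathbf{D}f(\mathbf{x})\|_2=1\text{ for all }\mathbf{x}\in\{0,1\}^2\}$, and $\mathbf{D}f$ denotes $\mathbf{x}\mapsto\mathbf{D}f(\mathbf{x})$. (In particular $\mathcal{D}(f_C)=\mathcal{D}(f_S)=\{[\mathbf{u},\mathbf{v}]:\mathbf{u},\mathbf{v}\in\mathbb{S}^1\}$.) Shared-optimal-coding problem. $$J^*_{\mathrm{ICR}}=\sup\Big\{\sum_{e=1}^E w_eJ_e(\mathbf{D}f)\;:\;f\in\mathcal{F},\ \mathbf{D}\in\mathcal{D}(f),\ \mathbf{D}\in\bigcap_{e=1}^E\operatorname*{arg\,max}_{\mathbf{A}\in\mathcal{D}(f)}J_e(\mathbf{A}f)\Big\}.$$ A pair $(f,\mathbf{D})$ satisfying these constraints is called feasible. Risk. For a classifier $g:\mathbb{S}^1\to\{0,1\}$, $\mathcal{L}_e(g\circ f)=P_e(g(f(\mathbf{X}))\ne Y)$, and $\mathcal{L}_{\mathrm{te}}$ is the same with $P_{\mathrm{te}}$. A classifier $g$ is source-optimal on $f$ if it minimises $\sum_{e}w_e\mathcal{L}_e(g\circ f)$ over all classifiers. Positive-noise construction with tolerance $\eta$. Given $a>0$, a positive integer $E$, positive weights $w_1,\dots,w_E$ summing to one, and $\eta>0$: training environments with $0<\delta_e\le\delta_{\max}<1/2$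 for all $e$ and a target environment with $\delta_{\mathrm{te}}=1-\delta_{\max}$, where $\delta_{\max}$ is small enough that $\frac{a^2}{2(1+a)}\delta_{\max}\le\eta$ and $\delta_{\max}\le\eta$. Such environments exist for every choice of $a,E,(w_e),\eta$; all of them, including the target, have the same input support $\{0,1\}^2$, and the $\delta_e$ can be chosen distinct. *)

(* Defs.v *)
From HB Require Import structures.
From mathcomp Require Import all_boot all_order all_algebra.
From mathcomp Require Import ring lra.
From mathcomp Require Import all_classical all_reals all_analysis.

Set Implicit Arguments.
Unset Strict Implicit.
Unset Printing Implicit Defensive.

Import Order.TTheory GRing.Theory Num.Theory.

Local Open Scope classical_set_scope.
Local Open Scope ring_scope.

(* MathComp-Analysis, over an arbitrary realType R.  Bits are booleans, an
   input x = (c, s) is a pair of bits and an outcome is a pair (x, y). *)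

Definition input : Type := (bool * bool)%type.

Section model.
Context {R : realType}.

(* The law P_d of (X, Y), as a probability mass function: the image of the
   product law Bernoulli(1/2) x Bernoulli(d) of (Y, B) under
   (y, b) |-> ((y, y (+) b), y). *)
Definition env_law (d : R) (z : input * bool) : R :=
  \sum_(yb : bool * bool | ((yb.1, yb.1 (+) yb.2), yb.1) == z)
    bernoulli_pmf (2^-1) yb.1 * bernoulli_pmf d yb.2.

Definition Prob (d : R) (A : pred (input * bool)) : R :=
  \sum_(z | A z) env_law d z.

(* E[Z | A] for a matrix-valued Z; it is only used for the events Y = y, which
   have probability 1/2. *)
Definition cond_mean m n (d : R) (Z : input * bool -> 'M[R]_(m, n))
    (A : pred (input * bool)) : 'M[R]_(m, n) :=
  (Prob d A)^-1 *: \sum_(z | A z) env_law d z *: Z z.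

(* The norm that MathComp-Analysis puts on matrices is the sup norm, hence an
   explicit Euclidean norm. *)
Definition norm2 n (v : 'cV[R]_n) : R := Num.sqrt (\sum_i v i 0 ^+ 2).

Definition circle : Type := {v : 'cV[R]_2 | norm2 v == 1}.

Definition encoder : Type := input -> circle.

Definition basis_vec (b : bool) : 'cV[R]_2 :=
  delta_mx (if b then 1 else 0) 0.

Lemma norm2_basis_vec b : norm2 (basis_vec b) == 1.
Proof.
rewrite /norm2 big_ord_recl big_ord1 !mxE /=.
by case: b; rewrite /= ?expr0n ?expr1n ?addr0 ?add0r sqrtr1.
Qed.

Definition circle_basis (b : bool) : circle :=
  exist (fun v : 'cV[R]_2 => norm2 v == 1) _ (norm2_basis_vec b).

Definition fC : encoder := fun x => circle_basis x.1.
Definition fS : encoder := fun x => circle_basis x.2.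

(* The coding objective takes any vector-valued map, so that it applies to
   x |-> D f(x) without a proof that this map stays on the circle. *)
Definition second_moment (d : R) (h : input -> 'cV[R]_2) (y : bool) : 'M[R]_2 :=
  cond_mean d (fun z => h z.1 *m (h z.1)^T) (fun z => z.2 == y).

Definition mean_moment (d : R) (h : input -> 'cV[R]_2) : 'M[R]_2 :=
  2^-1 *: (second_moment d h false + second_moment d h true).

Definition J (a d : R) (h : input -> 'cV[R]_2) : R :=
  2^-1 * ln (\det (1%:M + a *: mean_moment d h))
  - 4^-1 * \sum_(y : bool) ln (\det (1%:M + a *: second_moment d h y)).

Definition Jstar (a : R) : R := ln (1 + a / 2) - 2^-1 * ln (1 + a).

Definition encode (D : 'M[R]_2) (f : encoder) : input -> 'cV[R]_2 :=
  fun x => D *m val (f x).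

Definition coding_ops (f : encoder) : set 'M[R]_2 :=
  [set D | forall x, norm2 (encode D f x) = 1].

Definition argmax (T : Type) (A : set T) (F : T -> R) : set T :=
  [set x | A x /\ forall y, A y -> F y <= F x].

Definition optimal_ops (a d : R) (f : encoder) : set 'M[R]_2 :=
  argmax (coding_ops f) (fun A => J a d (encode A f)).

(* Training environments are indexed by 'I_E: weights w, mismatch
   probabilities delta. *)
Definition shared_optimal E (a : R) (delta : 'I_E -> R) (f : encoder) :
  set 'M[R]_2 := \bigcap_e optimal_ops a (delta e) f.

Definition feasible E (a : R) (delta : 'I_E -> R) (f : encoder) (D : 'M[R]_2) :
  Prop := coding_ops f D /\ shared_optimal a delta f D.

Definition objective E (a : R) (w delta : 'I_E -> R) (f : encoder)
    (D : 'M[R]_2) : R :=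
  \sum_e w e * J a (delta e) (encode D f).

(* The supremum is taken in the extended reals because sup is 0 by convention
   on sets of reals without a supremum. *)
Definition J_ICR E (a : R) (w delta : 'I_E -> R) : \bar R :=
  ereal_sup [set z | exists f D,
    feasible a delta f D /\ z = (objective a w delta f D)%:E].

Definition risk (d : R) (g : circle -> bool) (f : encoder) : R :=
  Prob d (fun z => g (f z.1) != z.2).

Definition source_optimal E (w delta : 'I_E -> R) (f : encoder)
    (g : circle -> bool) : Prop :=
  forall g' : circle -> bool,
    \sum_e w e * risk (delta e) g f <= \sum_e w e * risk (delta e) g' f.

Definition positive_noise E (a eta : R) (delta : 'I_E -> R) (dmax dte : R) :
  Prop :=
  [/\ forall e, 0 < delta e <= dmax,
      dmax < 2^-1,
      dte = 1 - dmax,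
      a ^+ 2 / (2 * (1 + a)) * dmax <= eta
    & dmax <= eta].

(* Not vacuous, even with distinct mismatch probabilities. *)
Lemma positive_noise_exists E (a eta : R) : 0 < a -> 0 < eta ->
  exists (delta : 'I_E -> R) (dmax dte : R),
    0 < dmax /\ injective delta /\ positive_noise a eta delta dmax dte.
Proof.
move=> a0 eta0; set k := a ^+ 2 / (2 * (1 + a)).
have k0 : 0 < k by rewrite /k divr_gt0 ?exprn_gt0// mulr_gt0//; lra.
pose m := Num.min (4^-1) (Num.min eta (eta / k)).
have m0 : 0 < m by rewrite !lt_min invr_gt0 ltr0n eta0 divr_gt0.
have [m4 me mk] : [/\ m <= 4^-1, m <= eta & m <= eta / k].
  by split; rewrite /m !ge_min lexx ?orbT.
exists (fun e => m * (e.+1%:R / E%:R)), m, (1 - m); split=> //; split.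
  move=> i j; have E0 : (0 < E)%N by case: i => i; apply: leq_ltn_trans.
  have EN : (E%:R : R) != 0 by rewrite pnatr_eq0 -lt0n.
  move/(mulfI (lt0r_neq0 m0))/(mulIf (invr_neq0 EN)) => /eqP.
  by rewrite eqr_nat eqSS => /eqP; apply: val_inj.
split=> //; first last.
- by rewrite mulrC -ler_pdivlMr.
- by lra.
move=> e; have E0 : (0 < E)%N by case: e => i; apply: leq_ltn_trans.
rewrite mulr_gt0 ?divr_gt0 ?ltr0n//=.
by rewrite ger_pMr// ler_pdivrMr ?ltr0n// mul1r ler_nat.
Qed.

End model.

Arguments circle : clear implicits.
Arguments encoder : clear implicits.

(* Main.v *)
(* For a symmetric 2x2 matrix M of trace 1, det (I + a M) = 1 + a + a^2 det M.
   All second moments of unit-valued maps have trace 1, so J depends only on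
   three determinants: the conditional ones are nonnegative and the mean one is
   at most 1/4, whence J <= Jstar for every admissible map.  This bound is
   reached by fC, whose conditional moments have rank one.  For D fS the
   determinants are t/4 and d(1-d) t, and the resulting ratio is increasing in t
   because d(1-d) < 1/4 unless d = 1/2.  The loss of fS with respect to Jstar is
   at most a^2 d(1-d) / (2(1+a)) by ln (1 + k) <= k.  As every source mismatch is
   below 1/2, the source-optimal classifier reads the bit s, and its target
   error is 1 - dmax. *)
Require Import Defs.
From HB Require Import structures.
From mathcomp Require Import all_boot all_order all_algebra.
From mathcomp Require Import ring lra.
From mathcomp Require Import all_classical all_reals all_analysis.

Set Implicit Arguments.
Unset Strict Implicit.
Unset Printing Implicit Defensive.

Import Order.TTheory GRing.Theory Num.Theory.

Local Open Scope classical_set_scope.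
Local Open Scope ring_scope.

(** * Determinants, traces and outer products in dimension two *)

Section two_dimensional.
Context {R : realType}.
Implicit Types (p q : 'cV[R]_2) (M : 'M[R]_2).

Lemma det2E M : \det M = M 0 0 * M 1 1 - M 0 1 * M 1 0.
Proof.
rewrite (expand_det_row _ 0) big_ord_recl big_ord1 /cofactor !det_mx11 !mxE/=.
have -> : lift 0 0 = 1 :> 'I_2 by apply: val_inj.
have -> : lift 1 0 = 0 :> 'I_2 by apply: val_inj.
by rewrite expr0 expr1; ring.
Qed.

Lemma mxtrace2E M : \tr M = M 0 0 + M 1 1.
Proof.
rewrite /mxtrace big_ord_recl big_ord1.
by congr (_ + M _ _); apply: val_inj.
Qed.

Lemma dot2E p q : (p^T *m q) 0 0 = p 0 0 * q 0 0 + p 1 0 * q 1 0.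
Proof.
rewrite mxE big_ord_recl big_ord1 !mxE.
by congr (_ + p _ _ * q _ _); apply: val_inj.
Qed.

Lemma norm2_eq1 n (v : 'cV[R]_n) : norm2 v = 1 <-> (v^T *m v) 0 0 = 1.
Proof.
have -> : (v^T *m v) 0 0 = \sum_i v i 0 ^+ 2.
  by rewrite mxE; apply: eq_bigr => i _; rewrite mxE expr2.
rewrite /norm2; split=> [n1|->]; last exact: sqrtr1.
by rewrite -[LHS]sqr_sqrtr ?n1 ?expr1n// sumr_ge0// => i _; exact: sqr_ge0.
Qed.

Lemma det_id_add_scale (a : R) M :
  \det (1%:M + a *: M) = 1 + a * \tr M + a ^+ 2 * \det M.
Proof. by rewrite !det2E mxtrace2E !mxE/=; ring. Qed.

(** The gap is [((M 0 0 - M 1 1) / 2) ^+ 2 + M 0 1 ^+ 2]. *)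
Lemma det_le_quarter_sqr_trace M : M^T = M -> \det M <= (\tr M) ^+ 2 / 4.
Proof.
move=> sM; have M10 : M 1 0 = M 0 1 by rewrite -[in LHS]sM mxE.
rewrite det2E mxtrace2E M10.
have := sqr_ge0 (M 0 0 - M 1 1); have := sqr_ge0 (M 0 1); nra.
Qed.

Lemma mxtrace_outer_comb (x y : R) p q :
  \tr (x *: (p *m p^T) + y *: (q *m q^T)) =
  x * (p^T *m p) 0 0 + y * (q^T *m q) 0 0.
Proof. by rewrite mxtraceD !mxtraceZ -!(mxtrace_mulC _^T) !trace_mx11. Qed.

(** The matrix is [P *m diag(x, y) *m P^T] with [P = [p, q]], and [(\det P) ^+ 2] is the Gram
    determinant of [p] and [q]. *)
Lemma det_outer_comb (x y : R) p q :
  \det (x *: (p *m p^T) + y *: (q *m q^T)) =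
  x * y * ((p^T *m p) 0 0 * (q^T *m q) 0 0 - (p^T *m q) 0 0 ^+ 2).
Proof. by rewrite det2E !dot2E !mxE !big_ord1 !mxE; ring. Qed.

(** Lagrange's identity: the defect in Cauchy-Schwarz is the square of the cross product. *)
Lemma sqr_dot_le1 p q : norm2 p = 1 -> norm2 q = 1 -> (p^T *m q) 0 0 ^+ 2 <= 1.
Proof.
move=> /norm2_eq1 + /norm2_eq1; rewrite !dot2E => np nq.
have := sqr_ge0 (p 0 0 * q 1 0 - p 1 0 * q 0 0).
have -> : (p 0 0 * q 1 0 - p 1 0 * q 0 0) ^+ 2 =
  (p 0 0 * p 0 0 + p 1 0 * p 1 0) * (q 0 0 * q 0 0 + q 1 0 * q 1 0) -
  (p 0 0 * q 0 0 + p 1 0 * q 1 0) ^+ 2 by ring.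
by rewrite np nq mulr1 subr_ge0.
Qed.

End two_dimensional.

(** * Expectations under the environment law *)

Section environment.
Context {R : realType}.

(** Each pair [(y, b)] hits exactly one outcome, so the sum pulls back along the image map. Values
    in any module let it serve both probabilities and matrix-valued means. *)
Lemma sum_env_law (V : lmodType R) (d : R) (A : pred (input * bool))
    (Z : input * bool -> V) :
  \sum_(z | A z) env_law d z *: Z z =
  \sum_(y : bool) \sum_(b : bool)
    if A ((y, y (+) b), y)
    then (2^-1 * bernoulli_pmf d b) *: Z ((y, y (+) b), y) else 0.
Proof.
under eq_bigr do rewrite scaler_suml.
rewrite (exchange_big_dep xpredT)//= pair_bigA/=; apply: eq_bigr => -[y b] _ /=.
rewrite big_mkcondl/= (big_pred1 ((y, y (+) b), y)) => [|z]; last first.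
  by rewrite eq_sym.
case: ifP => _ //; congr (_ * _ *: _); rewrite /bernoulli_pmf; case: y => //.
(* For [y = false] the fair bit has mass [1 - 2^-1], which is again [2^-1]. *)
by lra.
Qed.

Lemma ProbE (d : R) (A : pred (input * bool)) :
  Prob d A = 2^-1 * \sum_(y : bool)
    ((1 - d) * (A ((y, y), y))%:R + d * (A ((y, ~~ y), y))%:R).
Proof.
rewrite /Prob (eq_bigr (fun z => env_law d z *: (1 : R^o))); last first.
  by move=> z _; exact/esym/mulr1.
rewrite sum_env_law mulr_sumr; apply: eq_bigr => y _.
rewrite big_bool/= addbT addbF /bernoulli_pmf/= /GRing.scale/=.
by case: (A _); case: (A _); rewrite /=; ring.
Qed.

Lemma second_momentE (d : R) (h : input -> 'cV[R]_2) (y : bool) :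
  second_moment d h y = (1 - d) *: (h (y, y) *m (h (y, y))^T)
                      + d *: (h (y, ~~ y) *m (h (y, ~~ y))^T).
Proof.
rewrite /second_moment /cond_mean sum_env_law ProbE !big_bool /bernoulli_pmf.
have half : (2 : R) != 0 by rewrite pnatr_eq0.
(* The conditioning event has probability [2^-1]; its inverse cancels the factor [2^-1] of the joint
   law. *)
case: y; rewrite /= !(addr0, add0r, mulr0, mulr1) subrK mulr1 invrK.
  by rewrite addrC scalerDr !scalerA !mulrA divff// !mul1r.
by rewrite addrC scalerDr !scalerA !mulrA divff// !mul1r.
Qed.

(** * The objective of a unit-valued map in terms of determinants *)

Section objective.
Variables (a d : R) (h : input -> 'cV[R]_2).
Hypothesis h1 : forall x, norm2 (h x) = 1.

Lemma second_moment_trace y : \tr (second_moment d h y) = 1.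
Proof.
by rewrite second_momentE mxtrace_outer_comb !(norm2_eq1 _).1//; ring.
Qed.

Lemma second_moment_det y :
  \det (second_moment d h y) =
  d * (1 - d) * (1 - (((h (y, y))^T *m h (y, ~~ y)) 0 0) ^+ 2).
Proof.
by rewrite second_momentE det_outer_comb !(norm2_eq1 _).1//; ring.
Qed.

Lemma mean_moment_trace : \tr (mean_moment d h) = 1.
Proof. by rewrite mxtraceZ mxtraceD !second_moment_trace; field. Qed.

Lemma mean_moment_sym : (mean_moment d h)^T = mean_moment d h.
Proof.
apply/matrixP => i j; rewrite /mean_moment !second_momentE !mxE !big_ord1 !mxE.
by ring.
Qed.

Lemma mean_moment_det_le : \det (mean_moment d h) <= 4^-1.
Proof.
have := det_le_quarter_sqr_trace mean_moment_sym.
by rewrite mean_moment_trace expr1n mul1r.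
Qed.

(* Cauchy-Binet: the mean moment is a nonnegative combination of four outer
   products. *)
Lemma mean_moment_det_ge0 : 0 <= d <= 1 -> 0 <= \det (mean_moment d h).
Proof.
move=> /andP[d0 d1]; have e0 : 0 <= 1 - d by rewrite subr_ge0.
pose cross2 (p q : 'cV[R]_2) := (p 0 0 * q 1 0 - p 1 0 * q 0 0) ^+ 2.
have cross2_ge0 p q : 0 <= cross2 p q by exact: sqr_ge0.
have -> : \det (mean_moment d h) = 4^-1 *
    (d * (1 - d) * cross2 (h (true, true)) (h (true, false))
   + d * (1 - d) * cross2 (h (false, false)) (h (false, true))
   + (1 - d) * (1 - d) * cross2 (h (true, true)) (h (false, false))
   + d * d * cross2 (h (true, false)) (h (false, true))
   + d * (1 - d) * cross2 (h (true, true)) (h (false, true))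
   + d * (1 - d) * cross2 (h (true, false)) (h (false, false))).
  rewrite /mean_moment !second_momentE det2E !mxE !big_ord1 !mxE/=.
  by rewrite /cross2; field.
apply: mulr_ge0; first by rewrite invr_ge0 ler0n.
by rewrite !addr_ge0// mulr_ge0// mulr_ge0.
Qed.

Lemma JE :
  J a d h = 2^-1 * ln (1 + a + a ^+ 2 * \det (mean_moment d h))
  - 4^-1 * \sum_(y : bool) ln (1 + a + a ^+ 2 * (d * (1 - d) *
      (1 - (((h (y, y))^T *m h (y, ~~ y)) 0 0) ^+ 2))).
Proof.
rewrite /J det_id_add_scale mean_moment_trace mulr1.
congr (_ - _ * _); apply: eq_bigr => y _.
by rewrite det_id_add_scale second_moment_trace second_moment_det mulr1.
Qed.

End objective.

(** * Coding operators acting on [fS] *)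

Lemma encode_fS (D : 'M[R]_2) (x : input) :
  encode D fS x = if x.2 then col 1 D else col 0 D.
Proof. by rewrite /encode /fS/= /basis_vec; case: x.2; rewrite colE. Qed.

Lemma coding_ops_fS :
  coding_ops fS = [set D : 'M[R]_2 | norm2 (col 0 D) = 1 /\ norm2 (col 1 D) = 1].
Proof.
apply/seteqP; split=> D /=.
  by move=> D1; move: (D1 (false, false)) (D1 (false, true)); rewrite !encode_fS.
by move=> [u1 v1] x; rewrite encode_fS; case: x.2.
Qed.

Lemma coding_ops_id (f : encoder R) : coding_ops f (1%:M : 'M[R]_2).
Proof. by move=> x; rewrite /encode mul1mx; apply/eqP; exact: (valP (f x)). Qed.

Lemma id_cols_orthogonal :
  ((col 0 (1%:M : 'M[R]_2))^T *m col 1 1%:M) 0 0 = 0.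
Proof. by rewrite dot2E !mxE/=; ring. Qed.

Lemma mismatch_ge0 (d : R) : 0 <= d <= 1 -> 0 <= d * (1 - d).
Proof. by move=> /andP[d0 d1]; rewrite mulr_ge0// subr_ge0. Qed.

(* The paper's t: squared sine of the angle between the unit columns of D. *)
Definition sin2 (D : 'M[R]_2) : R := 1 - (((col 0 D)^T *m col 1 D) 0 0) ^+ 2.

Lemma sin2_bounds (D : 'M[R]_2) : coding_ops fS D -> 0 <= sin2 D <= 1.
Proof.
rewrite coding_ops_fS => -[u1 v1]; rewrite /sin2 subr_ge0 gerBl sqr_ge0 andbT.
exact: sqr_dot_le1.
Qed.

Lemma sin2_id : sin2 1%:M = 1.
Proof. by rewrite /sin2 id_cols_orthogonal expr0n subr0. Qed.

(** * Maximisers of the objective on [fS] *)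

Section optimality.
Variables (a d : R).
Hypotheses (a_gt0 : 0 < a) (d01 : 0 <= d <= 1).

Lemma J_fS (D : 'M[R]_2) : coding_ops fS D ->
  J a d (encode D fS) =
  2^-1 * ln ((1 + a + a ^+ 2 / 4 * sin2 D) /
             (1 + a + a ^+ 2 * d * (1 - d) * sin2 D)).
Proof.
move=> DS; have a0 := a_gt0; have /andP[g0 _] := sin2_bounds DS.
have c0 := mismatch_ge0 d01; have a2 := sqr_ge0 a.
rewrite (JE _ _ DS) big_bool !encode_fS /=.
have -> : \det (mean_moment d (encode D fS)) = 4^-1 * sin2 D.
  (* The bit [s] is uniform whatever [d] is, so [d] drops out of the mean moment. *)
  have -> : mean_moment d (encode D fS) =
      2^-1 *: (col 0 D *m (col 0 D)^T) + 2^-1 *: (col 1 D *m (col 1 D)^T).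
    rewrite /mean_moment !second_momentE !encode_fS/=.
    by apply/matrixP => i j; rewrite !mxE; field.
  move: DS; rewrite coding_ops_fS => -[/norm2_eq1 u1 /norm2_eq1 v1].
  by rewrite det_outer_comb u1 v1 /sin2; field.
have -> : ((col 1 D)^T *m col 0 D) 0 0 = ((col 0 D)^T *m col 1 D) 0 0.
  by rewrite !dot2E; ring.
have e1 : 0 <= a ^+ 2 / 4 * sin2 D by rewrite mulr_ge0// divr_ge0 ?sqr_ge0.
have e2 : 0 <= a ^+ 2 * d * (1 - d) * sin2 D
    by rewrite -(mulrA _ d) mulr_ge0// mulr_ge0 ?sqr_ge0.
rewrite -/(sin2 D) ln_div ?posrE; [|lra|lra].
have -> : a ^+ 2 * (4^-1 * sin2 D) = a ^+ 2 / 4 * sin2 D by ring.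
have -> : a ^+ 2 * (d * (1 - d) * sin2 D) = a ^+ 2 * d * (1 - d) * sin2 D by ring.
by lra.
Qed.

Lemma J_fS_lt (D D' : 'M[R]_2) : d != 2^-1 ->
  coding_ops fS D -> coding_ops fS D' -> sin2 D < sin2 D' ->
  J a d (encode D fS) < J a d (encode D' fS).
Proof.
move=> dh DS D'S gg; have a0 := a_gt0.
have /andP[g0 _] := sin2_bounds DS; have /andP[g0' _] := sin2_bounds D'S.
have c0 := mismatch_ge0 d01; have a2 : 0 < a ^+ 2 by rewrite exprn_gt0.
(* [d * (1 - d) = 4^-1 - (d - 2^-1) ^+ 2]. *)
have c4 : d * (1 - d) < 4^-1.
  have : 0 < (d - 2^-1) ^+ 2 by rewrite exprn_even_gt0//= subr_eq0.
  by nra.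
rewrite !J_fS// ltr_pM2l ?invr_gt0//.
move: (sin2 D) (sin2 D') g0 g0' gg => s t s0 t0 st.
have es : 0 <= a ^+ 2 / 4 * s by rewrite mulr_ge0// divr_ge0 ?sqr_ge0.
have et : 0 <= a ^+ 2 / 4 * t by rewrite mulr_ge0// divr_ge0 ?sqr_ge0.
have e1 : 0 <= a ^+ 2 * d * (1 - d) * s
    by rewrite -(mulrA _ d) mulr_ge0// mulr_ge0 ?sqr_ge0.
have e2 : 0 <= a ^+ 2 * d * (1 - d) * t
    by rewrite -(mulrA _ d) mulr_ge0// mulr_ge0 ?sqr_ge0.
have p1 : 0 < 1 + a + a ^+ 2 * d * (1 - d) * s by lra.
have p2 : 0 < 1 + a + a ^+ 2 * d * (1 - d) * t by lra.
rewrite ltr_ln ?posrE ?divr_gt0//; [|lra|lra].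
rewrite ltr_pdivrMr// [ltRHS]mulrAC ltr_pdivlMr// -subr_gt0.
(* After cross-multiplication the difference factors, with every factor positive. *)
have -> : (1 + a + a ^+ 2 / 4 * t) * (1 + a + a ^+ 2 * d * (1 - d) * s) -
          (1 + a + a ^+ 2 / 4 * s) * (1 + a + a ^+ 2 * d * (1 - d) * t) =
          (1 + a) * a ^+ 2 * (4^-1 - d * (1 - d)) * (t - s) by field.
by rewrite !mulr_gt0 ?subr_gt0// addr_gt0.
Qed.

(** Here [s] is independent of the label, and the numerator and denominator of the ratio
    coincide. *)
Lemma J_fS_half (D : 'M[R]_2) :
  d = 2^-1 -> coding_ops fS D -> J a d (encode D fS) = 0.
Proof.
move=> dh DS; rewrite J_fS// dh; have a0 := a_gt0.
have /andP[g0 _] := sin2_bounds DS.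
have e : 0 <= a ^+ 2 / 4 * sin2 D by rewrite mulr_ge0// divr_ge0 ?sqr_ge0.
have -> : a ^+ 2 * 2^-1 * (1 - 2^-1) = a ^+ 2 / 4 by field.
by rewrite divff ?ln1 ?mulr0//; apply: lt0r_neq0; lra.
Qed.

Lemma optimal_ops_fS_half : d = 2^-1 -> optimal_ops a d fS = coding_ops fS.
Proof.
move=> dh; apply/seteqP; split=> [D [DS _]|D DS]; first exact: DS.
split=> [|D' D'S]; first exact: DS.
by rewrite !J_fS_half.
Qed.

Lemma optimal_ops_fS : d != 2^-1 ->
  optimal_ops a d fS =
  [set D : 'M[R]_2 | [/\ norm2 (col 0 D) = 1, norm2 (col 1 D) = 1
                       & ((col 0 D)^T *m col 1 D) 0 0 = 0]].
Proof.
move=> dh; have I1 : coding_ops fS (1%:M : 'M[R]_2) := coding_ops_id _.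
apply/seteqP; split=> D.
  move=> [DS Dmax]; have := DS; rewrite coding_ops_fS => -[u1 v1]; split=> //.
  apply/eqP; rewrite -sqrf_eq0 eq_le sqr_ge0 andbT.
  (* Columns that are not orthogonal give [sin2 D < 1], so the identity, with [sin2] equal to 1,
     does strictly better. *)
  rewrite leNgt; apply/negP => c0; have := Dmax _ I1.
  by rewrite leNgt J_fS_lt// sin2_id /sin2 ltrBlDr ltrDl.
move=> /= [u1 v1 uv]; have DS : coding_ops fS D by rewrite coding_ops_fS.
split=> [|D' D'S]; first exact: DS.
have /andP[_] := sin2_bounds D'S.
have gD : sin2 D = 1 by rewrite /sin2 uv expr0n subr0.
rewrite -gD le_eqVlt => /predU1P[g|]; first by rewrite !J_fS// g.
by move=> /(J_fS_lt dh D'S DS)/ltW.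
Qed.

Lemma id_optimal_fS : optimal_ops a d fS 1%:M.
Proof.
have := coding_ops_id fS; have [dh|dh] := eqVneq d 2^-1.
  by rewrite optimal_ops_fS_half.
rewrite optimal_ops_fS// coding_ops_fS => -[u1 v1]; split=> //.
exact: id_cols_orthogonal.
Qed.

(** * The bound [Jstar], its attainment by [fC] and the gap of [fS] *)

Lemma ln_quarter : ln (1 + a + a ^+ 2 / 4) = 2 * ln (1 + a / 2).
Proof.
(* The largest mean determinant, [4^-1], yields a perfect square. *)
have -> : 1 + a + a ^+ 2 / 4 = (1 + a / 2) ^+ 2 by field.
have a0 := a_gt0; have p : 0 < a / 2 by rewrite divr_gt0.
by rewrite lnXn ?mulr_natl//; lra.
Qed.

Lemma J_le_Jstar (h : input -> 'cV[R]_2) :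
  (forall x, norm2 (h x) = 1) -> J a d h <= Jstar a.
Proof.
move=> h1; have a0 := a_gt0.
have c0 := mismatch_ge0 d01; have a2 : 0 < a ^+ 2 by rewrite exprn_gt0.
have term y : ln (1 + a) <= ln (1 + a + a ^+ 2 * (d * (1 - d) *
      (1 - (((h (y, y))^T *m h (y, ~~ y)) 0 0) ^+ 2))).
  have e : 0 <= a ^+ 2 * (d * (1 - d) *
      (1 - (((h (y, y))^T *m h (y, ~~ y)) 0 0) ^+ 2)).
    by rewrite mulr_ge0 ?(ltW a2)// mulr_ge0// subr_ge0 sqr_dot_le1.
  by rewrite ler_ln ?posrE; lra.
(* This keeps the argument of [ln] positive, so that monotonicity applies. *)
have dM : 0 <= \det (mean_moment d h).
  exact: mean_moment_det_ge0.
have mean : ln (1 + a + a ^+ 2 * \det (mean_moment d h)) <= 2 * ln (1 + a / 2).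
  have := mean_moment_det_le d h1; rewrite -(ler_pM2l a2) => le4.
  have e : 0 <= a ^+ 2 * \det (mean_moment d h) by rewrite mulr_ge0// ltW.
  by rewrite -ln_quarter ler_ln ?posrE; lra.
rewrite JE// big_bool /Jstar; move: (term true) (term false) mean => /=.
by lra.
Qed.

(** At the identity the denominator is [(1 + a) * (1 + k)], so the gap is exactly
    [2^-1 * ln (1 + k)]. *)
Lemma Jstar_sub_J_fS :
  Jstar a - J a d (encode 1%:M fS) <= a ^+ 2 / (2 * (1 + a)) * (d * (1 - d)).
Proof.
have a0 := a_gt0; have c0 := mismatch_ge0 d01.
rewrite J_fS ?sin2_id; last exact: coding_ops_id.
have e : 0 <= a ^+ 2 / 4 by rewrite divr_ge0 ?sqr_ge0.
have e' : 0 <= a ^+ 2 * d * (1 - d) by rewrite -(mulrA _ d) mulr_ge0 ?sqr_ge0.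
have a1 : 0 < 1 + a by lra.
set k := a ^+ 2 * d * (1 - d) / (1 + a).
have k0 : 0 <= k by rewrite divr_ge0// ltW.
have den : 1 + a + a ^+ 2 * d * (1 - d) = (1 + a) * (1 + k).
  by rewrite /k; field; exact: lt0r_neq0.
rewrite !mulr1 den ln_div ?posrE ?mulr_gt0//; [|lra|lra].
rewrite lnM ?posrE//; [|lra].
rewrite ln_quarter /Jstar.
have -> : a ^+ 2 / (2 * (1 + a)) * (d * (1 - d)) = 2^-1 * k.
  by rewrite /k; field; exact: lt0r_neq0.
have : ln (1 + k) <= k by apply: le_ln1Dx; lra.
by lra.
Qed.

Lemma J_fC_id : J a d (encode 1%:M fC) = Jstar a.
Proof.
have DC := coding_ops_id fC.
rewrite (JE _ _ DC) big_bool.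
have moment y : second_moment d (encode 1%:M fC) y =
    basis_vec y *m (basis_vec y)^T :> 'M[R]_2.
  by rewrite second_momentE /encode !mul1mx/= -scalerDl subrK scale1r.
(* The mean moment is half the identity. *)
have -> : \det (mean_moment d (encode 1%:M fC)) = 4^-1 :> R.
  by rewrite /mean_moment !moment det2E !mxE !big_ord1 !mxE/=; field.
rewrite /encode/= !mul1mx.
have norm b : ((basis_vec b)^T *m basis_vec b) 0 0 = 1 :> R.
  by apply/norm2_eq1/eqP; exact: norm2_basis_vec.
rewrite !norm expr1n subrr !mulr0 !addr0 ln_quarter /Jstar.
by lra.
Qed.

Lemma id_optimal_fC : optimal_ops a d fC 1%:M.
Proof.
split=> [|D DC]; first exact: coding_ops_id.
by rewrite J_fC_id; exact: J_le_Jstar.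
Qed.

End optimality.

(** * Classification risk on [fS] *)

Lemma risk_fS (d : R) (g : circle R -> bool) :
  risk d g fS =
  if g (circle_basis false) then
    if g (circle_basis true) then 2^-1 else 1 - d
  else if g (circle_basis true) then d else 2^-1.
Proof.
rewrite /risk ProbE big_bool/=.
by case: (g _); case: (g _); rewrite /=; field.
Qed.

(** A left inverse of [circle_basis], total on the circle; it is the witness for source
    optimality. *)
Definition bit_of (v : circle R) : bool := val v 1 0 == 1.

Lemma bit_of_basis b : bit_of (circle_basis b) = b.
Proof.
rewrite /bit_of/= /basis_vec mxE.
by case: b => /=; rewrite ?eqxx// eq_sym oner_eq0.
Qed.

Section source_risk.
Variables (E : nat) (w delta : 'I_E -> R).
Let m := \sum_e w e * delta e.

(** For fixed [g] the risk is affine in the mismatch, so the weighted risk is the risk at the mean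
    mismatch [m]. *)
Lemma source_risk_fS (g : circle R -> bool) : \sum_e w e = 1 ->
  \sum_e w e * risk (delta e) g fS =
  if g (circle_basis false) then
    if g (circle_basis true) then 2^-1 else 1 - m
  else if g (circle_basis true) then m else 2^-1.
Proof.
move=> w_sum1; under eq_bigr do rewrite risk_fS.
case: (g _); case: (g _) => //; rewrite -?mulr_suml ?w_sum1 ?mul1r//.
by under eq_bigr do rewrite mulrBr mulr1; rewrite sumrB w_sum1.
Qed.

Lemma bit_of_source_optimal :
  \sum_e w e = 1 -> m < 2^-1 -> source_optimal w delta fS bit_of.
Proof.
move=> w_sum1 m_half g; rewrite !source_risk_fS// !bit_of_basis.
by move: m m_half => x xh; case: (g _); case: (g _); lra.
Qed.

(** Reading the bit costs [m], strictly below the [2^-1] of a constant and the [1 - m] of a flipped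
    reading. *)
Lemma source_optimal_fS (g : circle R -> bool) :
  \sum_e w e = 1 -> m < 2^-1 -> source_optimal w delta fS g ->
  g (circle_basis false) = false /\ g (circle_basis true) = true.
Proof.
move=> w_sum1 m_half /(_ bit_of); rewrite !source_risk_fS// !bit_of_basis.
move: m m_half => x xh; case: (g _); case: (g _) => // le_x; exfalso; lra.
Qed.

End source_risk.
End environment.

(** * Assembly of the results *)

Theorem theorem4p1 (R : realType) (a : R) (E : nat) (w delta : 'I_E -> R)
    (a_gt0 : 0 < a) (E_gt0 : (0 < E)%N)
    (w_gt0 : forall e, 0 < w e) (w_sum1 : \sum_e w e = 1)
    (delta01 : forall e, 0 <= delta e <= 1) :
  (* closed form of the coding objective of D fS *)
  (forall (e : 'I_E) (D : 'M[R]_2), coding_ops fS D ->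
     let u := col 0 D in
     let v := col 1 D in
     let t := 1 - ((u^T *m v) 0 0) ^+ 2 in
     J a (delta e) (encode D fS) =
       2^-1 * ln ((1 + a + a ^+ 2 / 4 * t) /
                  (1 + a + a ^+ 2 * delta e * (1 - delta e) * t)))
  (* maximisers *)
  /\ (forall e : 'I_E, delta e != 2^-1 ->
        optimal_ops a (delta e) fS =
        [set D : 'M[R]_2 | [/\ norm2 (col 0 D) = 1, norm2 (col 1 D) = 1
                             & ((col 0 D)^T *m col 1 D) 0 0 = 0]])
  /\ (forall e : 'I_E, delta e = 2^-1 ->
        optimal_ops a (delta e) fS = coding_ops fS)
  (* 1 *)
  /\ shared_optimal a delta fS 1%:M
  (* 2 *)
  /\ (J_ICR a w delta = (Jstar a)%:E
      /\ feasible a delta fC 1%:M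
      /\ objective a w delta fC 1%:M = Jstar a)
  (* 3 *)
  /\ (forall eta dmax dte : R, 0 < eta ->
        positive_noise a eta delta dmax dte ->
        [/\ feasible a delta fS 1%:M,
            (`|J_ICR a w delta - (objective a w delta fS 1%:M)%:E|
               <= eta%:E)%E,
            exists g : circle R -> bool, source_optimal w delta fS g
          & forall g : circle R -> bool, source_optimal w delta fS g ->
              1 - eta <= risk dte g fS])
  (* reversed environment *)
  /\ (forall d : R, 0 <= d <= 1 -> optimal_ops a (1 - d) fS 1%:M).
Proof.
(* Constants are written as weighted averages so that bounds can be proved environment by
   environment. *)
have w_mean x : x = \sum_e w e * x by rewrite -mulr_suml w_sum1 mul1r.
have fsF : feasible a delta fS 1%:M.
  by split=> [|e _]; [exact: coding_ops_id|exact: id_optimal_fS].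
have fcF : feasible a delta fC 1%:M.
  by split=> [|e _]; [exact: coding_ops_id|exact: id_optimal_fC].
have fcJ : objective a w delta fC 1%:M = Jstar a.
  rewrite /objective; under eq_bigr do rewrite J_fC_id//.
  by rewrite -w_mean.
have obj_le f D : coding_ops f D -> objective a w delta f D <= Jstar a.
  move=> DF; rewrite [leRHS]w_mean; apply: ler_sum => e _.
  by rewrite ler_pM2l//; exact: J_le_Jstar.
have ICR : J_ICR a w delta = (Jstar a)%:E.
  apply/eqP; rewrite eq_le; apply/andP; split.
    apply: ge_ereal_sup => _ [f [D [[DF _] ->]]].
    by rewrite lee_fin obj_le.
  by apply: ereal_sup_ubound; exists fC, 1%:M; rewrite fcJ.
split; first by move=> e D DF; exact: J_fS.
split; first by move=> e dh; exact: optimal_ops_fS.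
split; first by move=> e dh; exact: optimal_ops_fS_half.
split; first by case: fsF.
split; first by [].
split; last by move=> d /andP[d0 d1]; apply: id_optimal_fS => //; lra.
move=> eta dmax dte eta0 [dle dmax2 dteE etaa etad].
have m_half : \sum_e w e * delta e < 2^-1.
  apply: le_lt_trans dmax2; rewrite [leRHS]w_mean.
  by apply: ler_sum => e _; rewrite ler_pM2l//; case/andP: (dle e).
split=> //.
- rewrite ICR -EFinB abse_EFin lee_fin ger0_norm; last first.
    by rewrite subr_ge0 obj_le//; case: fsF.
  rewrite /objective [Jstar a]w_mean -sumrB [leRHS]w_mean; apply: ler_sum => e _.
  rewrite -mulrBr ler_pM2l//.
  have k0 : 0 <= a ^+ 2 / (2 * (1 + a)).
    apply: divr_ge0; first exact: sqr_ge0.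
    by apply: mulr_ge0 => //; apply: addr_ge0 => //; exact: ltW.
  (* [delta e * (1 - delta e) <= delta e <= dmax]. *)
  have dd : delta e * (1 - delta e) <= dmax.
    have /andP[d0 d1] := dle e; apply: le_trans d1.
    by rewrite ger_pMr// gerBl ltW.
  have step := ler_wpM2l k0 dd.
  exact: le_trans (Jstar_sub_J_fS a_gt0 (delta01 e)) (le_trans step etaa).
- by exists bit_of; exact: bit_of_source_optimal.
- move=> g /(source_optimal_fS w_sum1 m_half)[g0 g1].
  by rewrite risk_fS g0 g1 dteE lerD2l lerN2.
Qed.
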